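(* Let $n\in\mathbb{N}$, $\varepsilon_0>0$, $\delta_0\in[0,1]$, let $\mathcal{D}$ be a domain, and let $\mathcal{R}^{(1)},\dots,\mathcal{R}^{(n)}$ be such that $\mathcal{R}^{(i)}(z_{1:i-1},\cdot)$ is an $(\varepsilon_0,\delta_0)$-DP local randomizer for every $i\in[n]$ and every auxiliary input $z_{1:i-1}$; let $\mathcal{A}_{\rm s}$ be the corresponding shuffled adaptive protocol. Then for any $\delta\in(0,1]$ such that $\varepsilon_0\le\log\left(\frac{n}{16\log(2/\delta)}\right)$, $\mathcal{A}_{\rm s}$ is $\left(\varepsilon,\ \delta+(e^{\varepsilon}+1)(1+e^{-\varepsilon_0}/2)\,n\delta_0\right)$-DP, where $$\varepsilon=\log\left(1+\frac{e^{\varepsilon_0}-1}{e^{\varepsilon_0}+1}\left(\frac{8\sqrt{e^{\varepsilon_0}\log(4/\delta)}}{\sqrt{n}}+\frac{8e^{\varepsilon_0}}{n}\right)\right).$$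
   Context: Two random variables $P,Q$ on the same space are $(\varepsilon,\delta)$-indistinguishable if for every event $E$, $e^{-\varepsilon}(\Pr(Q\in E)-\delta)\le\Pr(P\in E)\le e^{\varepsilon}\Pr(Q\in E)+\delta$. A randomized algorithm $\mathcal{R}:\mathcal{D}\to\mathcal{S}$ is an $(\varepsilon,\delta)$-DP local randomizer if for all $x,x'\in\mathcal{D}$, $\mathcal{R}(x)$ and $\mathcal{R}(x')$ are $(\varepsilon,\delta)$-indistinguishable. Datasets in $\mathcal{D}^n$ are neighboring if they differ in exactly one coordinate; an algorithm $\mathcal{A}$ on $\mathcal{D}^n$ is $(\varepsilon,\delta)$-DP if its outputs on any neighboring datasets are $(\varepsilon,\delta)$-indistinguishable. Shuffled adaptive protocol: for $i\in[n]$, $\mathcal{R}^{(i)}:\mathcal{S}^{(1)}\times\cdots\times\mathcal{S}^{(i-1)}\times\mathcal{D}\to\mathcal{S}^{(i)}$ is a randomized algorithm; $\mathcal{A}_{\rm s}$, given $x_{1:n}\in\mathcal{D}^n$, samples a uniformly random permutation $\pi$ of $[n]$, then sequentially computes $z_i=\mathcal{R}^{(i)}(z_{1:i-1},x_{\pi(i)})$ for $i=1,\dots,n$ and outputs $z_{1:n}$. *)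

(* Defs.v *)
From HB Require Import structures.
From mathcomp Require Import all_boot all_order all_algebra all_fingroup.
From mathcomp Require Import all_classical all_reals all_analysis.
Set Implicit Arguments. Unset Strict Implicit. Unset Printing Implicit Defensive.
Import Order.TTheory GRing.Theory Num.Theory.

Local Open Scope classical_set_scope.
Local Open Scope ring_scope.

(* ---------- histories z_{1:i} = (((tt, z_1), z_2), ..., z_i) ---------- *)
(* The output space of the i-th randomizer (0-indexed) is S i. *)
Fixpoint histd (dS : nat -> measure_display) (i : nat) : measure_display :=
  match i with
  | 0 => default_measure_display
  | i'.+1 => (histd dS i', dS i').-prod
  end.

Fixpoint hist (dS : nat -> measure_display)
    (S : forall i, measurableType (dS i)) (i : nat) : measurableType (histd dS i) :=
  match i as k return measurableType (histd dS k) with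
  | 0 => unit
  | i'.+1 => (hist S i' * S i')%type
  end.

Definition indist (R : realType) d (T : measurableType d)
    (P Q : set T -> \bar R) (eps del : R) : Prop :=
  forall E : set T, measurable E ->
    ((expR (- eps))%:E * (Q E - del%:E) <= P E)%E /\
    (P E <= (expR eps)%:E * Q E + del%:E)%E.

Definition dp_local_randomizer (R : realType) (D : Type) d (Y : measurableType d)
    (M : D -> {measure set Y -> \bar R}) (eps del : R) : Prop :=
  forall x x' : D, indist (M x) (M x') eps del.

Definition neighboring (D : Type) (n : nat) (x x' : 'I_n -> D) : Prop :=
  exists i : 'I_n, x i <> x' i /\ forall j : 'I_n, j != i -> x j = x' j.

Section Protocol.
Variables (R : realType) (D : Type) (dS : nat -> measure_display)
  (S : forall i, measurableType (dS i)).

(* the conditional law of z_{i+1} given the history, when the protocol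
   is run on the permuted dataset (x_{pi(0)}, ..., x_{pi(n-1)}) *)
Definition step_law (n : nat)
    (Rz : forall i, D -> R.-pker (hist S i) ~> S i)
    (x : 'I_n -> D) (pi : 'S_n) (i : nat) (h : hist S i)
    : {measure set S i -> \bar R} :=
  match (insub i : option 'I_n) with
  | Some j => Rz i (x (pi j)) h
  | None => mzero
  end.

(* cont m i g h = E[ g(z_{1:m+i}) | z_{1:i} = h ]  (iterated integral) *)
Fixpoint cont (n : nat) (Rz : forall i, D -> R.-pker (hist S i) ~> S i)
    (x : 'I_n -> D) (pi : 'S_n) (m : nat) {struct m}
    : forall i, (hist S (m + i)%N -> \bar R) -> hist S i -> \bar R :=
  match m as m0 return forall i, (hist S (m0 + i)%N -> \bar R) -> hist S i -> \bar R with
  | 0 => fun i g => g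
  | m'.+1 => fun i g h =>
      (\int[step_law Rz x pi h]_z
         @cont n Rz x pi m' (i.+1)
           (eq_rect (m' + i)%N.+1 (fun k => hist S k -> \bar R) g
              (m' + i.+1)%N (esym (addnS m' i))) (h, z))%E
  end.

Definition perm_run_prob (n : nat) (Rz : forall i, D -> R.-pker (hist S i) ~> S i)
    (x : 'I_n -> D) (pi : 'S_n) (E : set (hist S n)) : \bar R :=
  @cont n Rz x pi n 0
    (eq_rect n (fun k => hist S k -> \bar R) (fun z => (\1_E z)%:E)
       (n + 0)%N (esym (addn0 n))) tt.

Definition shuffled_prob (n : nat) (Rz : forall i, D -> R.-pker (hist S i) ~> S i)
    (x : 'I_n -> D) (E : set (hist S n)) : \bar R :=
  ((n`!%:R)^-1%:E * \sum_(pi : 'S_n) perm_run_prob Rz x pi E)%E.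

End Protocol.

Definition dp_algorithm (R : realType) (D : Type) (n : nat) d (T : measurableType d)
    (Alg : ('I_n -> D) -> set T -> \bar R) (eps del : R) : Prop :=
  forall x x' : 'I_n -> D, neighboring x x' -> indist (Alg x) (Alg x') eps del.

(* Main.v *)
Require Import Defs.
From HB Require Import structures.
From mathcomp Require Import all_boot all_order all_algebra all_fingroup.
From mathcomp Require Import all_classical all_reals all_analysis.
From mathcomp Require Import measurable_realfun ring lra.
Set Implicit Arguments. Unset Strict Implicit. Unset Printing Implicit Defensive.
Import Order.TTheory GRing.Theory Num.Theory.
Local Open Scope ring_scope.

(* Let u0 be the differing user and p = e^-eps0. Given the history, the laws of the two inputs of u0
   are, up to mass del0, mixtures of two laws Q0, Q1 with weights al, 1 - al (resp. 1 - al, al), where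
   al = e^eps0 / (e^eps0 + 1); the law of every other user u is p/2 (Q0 + Q1) + (1 - p) L_u: each user
   is a clone of u0 with probability p. Once all labels (0, 1 or "own") are exposed, only the position
   of u0 among the clones is unknown, so the likelihood ratio is governed by the numbers of labels 0
   and 1, which a Chernoff bound controls.

   The mixtures need not depend measurably on the history, so the two shuffled laws are not replaced by
   approximations; instead the linear combination sum_pi c(pi) Pr_pi - c'(pi) Pr'_pi is bounded by
   backward induction on time, splitting the step law separately at each history. *)

(** * Chernoff bound for the number of clones *)

Lemma expR_ge_quad (R : realType) (s : R) : 0 <= s -> 1 + s + s ^+ 2 / 2 <= expR s.
Proof.
move=> s0.
have -> : 1 + s + s ^+ 2 / 2 = series (exp_coeff s) 3%N.
  rewrite /series /= !big_nat_recr //= big_geq // /exp_coeff /=.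
  by rewrite !factS fact0 /=; field.
have h : nondecreasing_seq (series (exp_coeff s)).
  by apply: nondecreasing_series => n _ _; exact: exp_coeff_ge0.
exact: (nondecreasing_cvgn_le h (is_cvg_series_exp_coeff s) 3%N).
Qed.

Lemma expRN_le_quad (R : realType) (s : R) : 0 <= s ->
  expR (- s) <= 1 - s + s ^+ 2 / 2.
Proof.
move=> s0; have h := expR_ge_quad s0.
have e0 := expR_gt0 s; rewrite expRN -(ler_pM2r e0) mulVf ?gt_eqF //.
have p0 : 0 <= 1 - s + s ^+ 2 / 2 by have := sqr_ge0 (s - 1); nra.
apply: le_trans (ler_wpM2l p0 h).
(* The product (1 - s + s^2/2)(1 + s + s^2/2) equals 1 + s^4/4. *)
by have := sqr_ge0 (s ^+ 2); lra.
Qed.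

Lemma expR_le_quad (R : realType) (t : R) : 0 <= t <= 1 / 2 ->
  expR t <= 1 + t + 2 * t ^+ 2.
Proof.
move=> /andP[t0 t1]; have h := expR_ge1Dx (- t).
have e0 := expR_gt0 t; move: h; rewrite expRN -(ler_pM2r e0) mulVf ?gt_eqF // => h.
have p0 : 0 <= 1 + t + 2 * t ^+ 2 by have := sqr_ge0 t; lra.
have := ler_wpM2l p0 h.
(* Here (1 + t + 2t^2)(1 - t) = 1 + t^2 (1 - 2t), which is at least 1 exactly because t <= 1/2. *)
have : 0 <= expR t * (t ^+ 2 * (1 - 2 * t)).
  by apply: mulr_ge0; [exact: ltW | apply: mulr_ge0; [exact: sqr_ge0 | lra]].
lra.
Qed.

Lemma ln2_ge_half (R : realType) : 1 / 2 <= ln (2 : R).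
Proof.
have h : expR (1 / 2 : R) <= 1 + 1 / 2 + 2 * (1 / 2) ^+ 2.
  by apply: expR_le_quad; lra.
by rewrite -ler_expR lnK ?posrE //; lra.
Qed.

(* With [s] (resp. [s']) the number of labels 0 (resp. 1) among [m / p] trials, this bounds the
   logarithm of the exponential moment of [t (1 + s - (1 + x) s')]. *)
Lemma clone_moment_bound (R : realType) (del q m x : R) :
  0 < del <= 1 -> 16 * ln (2 / del) <= q -> q - 1 <= m -> 0 <= x ->
  x ^+ 2 * q = 64 * ln (4 / del) ->
  exists2 t, 0 <= t &
    t + m / 2 * (expR t + expR (- ((1 + x) * t)) - 2) <= ln del.
Proof.
move=> /andP[d0 d1] hq hm x0 hx.
have l2 := ln2_ge_half R.
have lnd : ln del <= 0 by exact: ln_le0.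
have E2 : ln (2 / del) = ln 2 - ln del by rewrite ln_div ?posrE.
have E4 : ln (4 / del) = 2 * ln 2 - ln del.
  rewrite ln_div ?posrE // (_ : 4 = 2 ^+ 2 :> R); last by lra.
  by rewrite lnXn // mulr2n; lra.
move: hq hx; rewrite E2 E4; move: (ln 2) (ln del) l2 lnd => l d l2 d0' hq hx.
(* [K] is the coefficient of t^2 once both exponentials are replaced by their quadratic upper
   bounds: 2 from [expR_le_quad], (1 + x)^2 / 2 from [expRN_le_quad]. *)
pose K := 2 + (1 + x) ^+ 2 / 2.
have K0 : 0 < K by rewrite /K; have := sqr_ge0 (1 + x); lra.
have Kx : x <= K by rewrite /K; have := sqr_ge0 x; lra.
have K3 : K <= 3 + x ^+ 2 by rewrite /K; have := sqr_ge0 (x - 1); lra.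
have KL : K * (l - d) <= 7 * (2 * l - d).
  have : x ^+ 2 * (16 * (l - d)) <= 64 * (2 * l - d).
    by rewrite -hx; apply: ler_wpM2l => //; exact: sqr_ge0.
  have : K * (l - d) <= (3 + x ^+ 2) * (l - d) by apply: ler_wpM2r => //; lra.
  lra.
(* Since l >= 1/2 and d <= 0, q >= 16 (l - d) >= 8, hence m >= q - 1 >= 7q/8; the 7 is 64 * (7/8) /
   8. *)
have mx : 7 * (2 * l - d) <= m * x ^+ 2 / 8.
  have : (7 / 8 * q) * x ^+ 2 <= m * x ^+ 2.
    by apply: ler_wpM2r; [exact: sqr_ge0 | lra].
  lra.
have key : x / 2 - K * d <= m * x ^+ 2 / 8.
  have : K * (1 / 2) <= K * l by apply: ler_wpM2l => //; exact: ltW.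
  lra.
(* The minimiser of -x t + K t^2, with minimum -x^2 / (4K). Multiplied by K, the claim becomes
   [key]; and x <= K gives t <= 1/2. *)
pose t := x / (2 * K).
have t0 : 0 <= t by rewrite /t divr_ge0 // mulr_ge0 // ltW.
have t1 : t <= 1 / 2 by rewrite /t ler_pdivrMr; [lra | exact: mulr_gt0].
exists t => //.
have h1 : expR t <= 1 + t + 2 * t ^+ 2 by apply: expR_le_quad; rewrite t0.
have h2 : expR (- ((1 + x) * t)) <= 1 - (1 + x) * t + ((1 + x) * t) ^+ 2 / 2.
  by apply: expRN_le_quad; apply: mulr_ge0 => //; lra.
have m0 : 0 <= m / 2 by lra.
have h3 : expR t + expR (- ((1 + x) * t)) - 2 <= - x * t + K * t ^+ 2.
  rewrite /K; lra.
apply: le_trans (lerD (lexx t) (ler_wpM2l m0 h3)) _.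
rewrite -(ler_pM2l K0).
have tK : K * t = x / 2 by rewrite /t; field; rewrite gt_eqF.
have -> : K * (t + m / 2 * (- x * t + K * t ^+ 2)) =
  K * t + m / 2 * (- x * (K * t) + (K * t) ^+ 2) by ring.
rewrite tK; lra.
Qed.

(** * Label counting *)

Section Labels.
Variables (R : realType) (n : nat) (u0 : 'I_n) (p : R).
Local Notation label := (bool + 'I_n)%type.

(** The label [inl b] stands for the shared law Q_b and [inr v] for the own law of user v. As the
    user is part of the label, the law drawn depends on the label alone: once the labels are known,
    the permutation no longer influences the output. *)
Definition clone_weight (u : 'I_n) (l : label) : R :=
  match l with inl _ => p / 2 | inr v => (v == u)%:R * (1 - p) end.

Definition pure_weight (b : bool) (u : 'I_n) (l : label) : R :=
  if u == u0 then (l == inl b)%:R else clone_weight u l.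

Definition mixed_weight (al : R) (b : bool) (u : 'I_n) (l : label) : R :=
  if u == u0 then al * (l == inl b)%:R + (1 - al) * (l == inl (~~ b))%:R
  else clone_weight u l.

Definition pure_prob (b : bool) (pi : 'S_n) (w : {ffun 'I_n -> label}) : R :=
  \prod_k pure_weight b (pi k) (w k).

Definition count_label (b : bool) (w : {ffun 'I_n -> label}) : R :=
  \sum_k (w k == inl b)%:R.

Hypothesis p01 : 0 <= p <= 1.

Lemma clone_weight_ge0 u l : 0 <= clone_weight u l.
Proof.
case/andP: p01 => p0 p1; case: l => [b|v] /=; first by rewrite divr_ge0.
by rewrite mulr_ge0 ?ler0n ?subr_ge0.
Qed.

Lemma pure_weight_ge0 b u l : 0 <= pure_weight b u l.
Proof. by rewrite /pure_weight; case: ifP => _; rewrite ?ler0n ?clone_weight_ge0. Qed.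

Lemma mixed_weight_ge0 al b u l : 0 <= al <= 1 -> 0 <= mixed_weight al b u l.
Proof.
case/andP=> a0 a1; rewrite /mixed_weight; case: ifP => _; last exact: clone_weight_ge0.
by rewrite addr_ge0 // mulr_ge0 ?ler0n ?subr_ge0.
Qed.

Lemma sum_label (f : label -> R) :
  \sum_l f l = f (inl false) + f (inl true) + \sum_v f (inr v).
Proof.
rewrite big_sumType /=; congr (_ + _).
by rewrite (bigD1 false) //= (bigD1 true) //= big1 ?addr0 // => -[].
Qed.

Lemma sum_clone_weight (f : label -> R) u :
  \sum_l clone_weight u l * f l =
  p / 2 * (f (inl false) + f (inl true)) + (1 - p) * f (inr u).
Proof.
rewrite sum_label /= -mulrDr (bigD1 u) //= eqxx mul1r big1 ?addr0 //.
by move=> v /negPf vu; rewrite vu !mul0r.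
Qed.

Lemma sum_mixed_weight al b u : \sum_l mixed_weight al b u l = 1.
Proof.
rewrite /mixed_weight; case: (u == u0).
  rewrite sum_label big1 => [|v _]; last by rewrite !mulr0 addr0.
  by case: b; rewrite /=; ring.
transitivity (\sum_l clone_weight u l * 1); first by apply: eq_bigr => l; rewrite mulr1.
by rewrite sum_clone_weight; field.
Qed.

Lemma pure_prob_ge0 b pi w : 0 <= pure_prob b pi w.
Proof. by apply: prodr_ge0 => k _; exact: pure_weight_ge0. Qed.

Lemma count_label_ge0 b w : 0 <= count_label b w.
Proof. by apply: sumr_ge0. Qed.

Lemma pure_probE b pi w : let k0 := (pi^-1%g : 'S_n) u0 in
  pure_prob b pi w =
  (w k0 == inl b)%:R * \prod_(k | k != k0) clone_weight (pi k) (w k).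
Proof.
move=> k0; rewrite /pure_prob (bigD1 k0) //= {1}/pure_weight permKV eqxx.
congr (_ * _); apply: eq_bigr => k kk0; rewrite /pure_weight ifN //.
by apply: contraNneq kk0 => ku; rewrite /k0 -ku permK.
Qed.

(** Only the factor at the position of [u0] involves [al], and it is affine in [al]. *)
Lemma mixed_probE al b (pi : 'S_n) (w : {ffun 'I_n -> label}) :
  \prod_k mixed_weight al b (pi k) (w k) =
  al * pure_prob b pi w + (1 - al) * pure_prob (~~ b) pi w.
Proof.
rewrite !pure_probE (bigD1 ((pi^-1%g : 'S_n) u0)) //= {1}/mixed_weight permKV eqxx.
rewrite !mulrA -mulrDl; congr (_ * _); apply: eq_bigr => k kk0.
rewrite /mixed_weight ifN //.
by apply: contraNneq kk0 => ku; rewrite -ku permK.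
Qed.

(* Exchanging the position of [u0] with another labelled position [k] is an
   involution on pairs (permutation, position). *)
Lemma count_label_swap w :
  count_label true w * (\sum_pi pure_prob false pi w) =
  count_label false w * (\sum_pi pure_prob true pi w).
Proof.
rewrite !mulr_sumr.
under eq_bigr do rewrite mulr_suml.
under [RHS]eq_bigr do rewrite mulr_suml.
rewrite !pair_bigA /=.
pose phi (q : 'S_n * 'I_n) : 'S_n * 'I_n :=
  ((tperm q.2 ((q.1^-1%g : 'S_n) u0) * q.1)%g, (q.1^-1%g : 'S_n) u0).
have inv0 q : ((tperm q.2 ((q.1^-1%g : 'S_n) u0) * q.1)^-1%g : 'S_n) u0 = q.2.
  by rewrite invMg permM tpermV tpermR.
have phiK : involutive phi.
  by case=> pi k; rewrite /phi /= (inv0 (pi, k)) /= mulgA tpermC tperm2 mul1g.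
rewrite [RHS](reindex_inj (inv_inj phiK)) /=; apply: eq_bigr => -[pi k] _ /=.
rewrite !pure_probE (inv0 (pi, k)) /=; set k0 := (pi^-1%g : 'S_n) u0.
have [wk|wk] := eqVneq (w k) (inl true); last by rewrite !mul0r mulr0.
have [wk0|wk0] := eqVneq (w k0) (inl false); last by rewrite !mul0r mulr0.
rewrite !mul1r.
have kk0 : k != k0 by apply: contra_eq_neq wk => ->; rewrite wk0.
(* The factors at the two exchanged positions are both p/2, since a label [inl _] has the same
   weight for every clone; elsewhere the two permutations agree. *)
rewrite (bigD1 k) //= [RHS](bigD1 k0) 1?eq_sym //= wk wk0 /=; congr (_ * _).
rewrite [RHS](eq_bigl (fun i => (i != k0) && (i != k))); last by move=> i; rewrite andbC.
apply: eq_bigr => i /andP[i0 i1]; rewrite permM tpermD // eq_sym //.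
Qed.

Lemma pure_prob_count0 b w : count_label b w = 0 -> \sum_pi pure_prob b pi w = 0.
Proof.
move=> /psumr_eq0P w0; apply: big1 => pi _.
by rewrite pure_probE w0 ?mul0r // => k _; rewrite ler0n.
Qed.

(** Write A, B for the two sums of pure probabilities and c0, c1 for the label counts, so that c1 A
    = c0 B by [count_label_swap]. If c0 <= (1 + X) c1, then A <= (1 + X) B and the excess is not
    positive. Otherwise it is at most (2 al - 1) A, and the exponential is at least 1: it dominates
    the indicator of the bad event, as in a Chernoff bound. *)
Lemma excess_bound (X t al : R) (w : {ffun 'I_n -> label}) : 0 <= X -> 0 <= t -> 1 / 2 <= al <= 1 ->
  Num.max (\sum_(pi : 'S_n) (\prod_k mixed_weight al false (pi k) (w k) -
      (1 + (2 * al - 1) * X) * \prod_k mixed_weight al true (pi k) (w k))) 0 <=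
  (2 * al - 1) * ((\sum_pi pure_prob false pi w) *
    expR (t * (count_label false w - (1 + X) * count_label true w))).
Proof.
move=> X0 t0 /andP[al0 al1].
under eq_bigr do rewrite !mixed_probE /=.
rewrite big_split /= sumrN -mulr_sumr !big_split /= -!mulr_sumr.
have := count_label_swap w; have := @pure_prob_count0 false w.
have A0 : 0 <= \sum_pi pure_prob false pi w by apply: sumr_ge0 => ? _; exact: pure_prob_ge0.
have B0 : 0 <= \sum_pi pure_prob true pi w by apply: sumr_ge0 => ? _; exact: pure_prob_ge0.
have := count_label_ge0 false w; have := count_label_ge0 true w.
move: (count_label true w) (count_label false w)
  (\sum_pi pure_prob false pi w) (\sum_pi pure_prob true pi w) A0 B0.
move=> c1 c0 A B A0 B0 c10 c00 cA swp.
have D0 : 0 <= 2 * al - 1 by lra.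
have -> : al * A + (1 - al) * B - (1 + (2 * al - 1) * X) * (al * B + (1 - al) * A) =
  (2 * al - 1) * (A - B - X * ((1 - al) * A + al * B)) by ring.
have S0 : 0 <= X * ((1 - al) * A + al * B).
  apply: mulr_ge0 => //; apply: addr_ge0; apply: mulr_ge0 => //; lra.
rewrite ge_max; apply/andP; split; last by rewrite !mulr_ge0 ?expR_ge0.
apply: ler_wpM2l => //.
have [lt_c|ge_c] := ltP ((1 + X) * c1) c0.
  have : 1 <= expR (t * (c0 - (1 + X) * c1)).
    by rewrite -[leLHS]expR0 ler_expR mulr_ge0 // subr_ge0 ltW.
  by move=> /(ler_wpM2l A0); lra.
apply: (@le_trans _ _ 0); last by rewrite mulr_ge0 ?expR_ge0.
(* For c1 = 0 the exchange identity cannot be divided by c1; but then c0 = 0 as well, and A vanishes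
   because [u0] would have to carry a label 0. *)
have [c1z|c1nz] := eqVneq c1 0.
  have c0z : c0 = 0 by apply/eqP; rewrite eq_le c00 andbT; move: ge_c; rewrite c1z mulr0.
  by rewrite cA // in S0 *; lra.
have c1p : 0 < c1 by rewrite lt_def c1nz.
have AB : A <= (1 + X) * B.
  rewrite -(ler_pM2l c1p) swp mulrA (mulrC c1); exact: ler_wpM2r.
have [le_AB|lt_AB] := leP A B; first by lra.
have : 0 <= X * ((1 - al) * (A - B)) by rewrite !mulr_ge0 //; lra.
lra.
Qed.

(** Given the permutation, the labels are independent, so the moment factorises: the position of
    [u0] gives [expR a0], and each of the n - 1 others the moment of one clone. *)
Lemma pure_prob_moment (a0 a1 : R) pi :
  \sum_w pure_prob false pi w *
     expR (a0 * count_label false w + a1 * count_label true w) =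
  expR a0 * (1 - p + p / 2 * (expR a0 + expR a1)) ^+ n.-1.
Proof.
pose g (l : label) := match l with inl false => expR a0 | inl true => expR a1 | _ => 1 end.
have E w : expR (a0 * count_label false w + a1 * count_label true w) = \prod_k g (w k).
  rewrite /count_label !mulr_sumr -big_split /= expR_sum; apply: eq_bigr => k _.
  case: (w k) => [[]|v] /=;
    by rewrite ?eqxx ?mulr0 ?mulr1 ?addr0 ?add0r ?expR0.
under eq_bigr do rewrite E -big_split /=.
rewrite -(bigA_distr_bigA (fun k l => pure_weight false (pi k) l * g l)) /=.
rewrite (bigD1 ((pi^-1%g : 'S_n) u0)) //=; congr (_ * _).
  rewrite {1}/pure_weight permKV eqxx.
  rewrite (bigD1 (inl false)) //= mul1r big1 ?addr0 //.
  by move=> l /negPf ->; rewrite mul0r.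
rewrite (eq_bigr (fun=> 1 - p + p / 2 * (expR a0 + expR a1))).
  by rewrite prodr_const cardC1 card_ord.
move=> k kk0; have /negPf ku0 : pi k != u0.
  by apply: contraNneq kk0 => ku; rewrite -ku permK.
under eq_bigr do rewrite /pure_weight ku0.
by rewrite sum_clone_weight /= mulr1 addrC.
Qed.

Lemma total_excess_bound (X t al : R) : 0 <= X -> 0 <= t -> 1 / 2 <= al <= 1 ->
  \sum_(w : {ffun 'I_n -> label})
    Num.max (\sum_(pi : 'S_n) (\prod_k mixed_weight al false (pi k) (w k) -
      (1 + (2 * al - 1) * X) * \prod_k mixed_weight al true (pi k) (w k))) 0 <=
  n`!%:R * (expR t *
    (1 - p + p / 2 * (expR t + expR (- ((1 + X) * t)))) ^+ n.-1).
Proof.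
move=> X0 t0 al01.
apply: le_trans (ler_sum _ (fun w _ => excess_bound w X0 t0 al01)) _.
rewrite -mulr_sumr; under eq_bigr do rewrite mulr_suml.
rewrite exchange_big /= (eq_bigr (fun=> expR t *
    (1 - p + p / 2 * (expR t + expR (- ((1 + X) * t)))) ^+ n.-1)); last first.
  move=> pi _; rewrite -(pure_prob_moment _ _ pi); apply: eq_bigr => w _.
  by congr (_ * expR _); ring.
rewrite sumr_const card_Sn -[_ *+ n`!]mulr_natl.
(* The factor 2 al - 1 <= 1 is bounded by 1. *)
apply: ler_piMl; last by case/andP: al01; lra.
case/andP: p01 => p0 p1; rewrite !mulr_ge0 ?expR_ge0 // exprn_ge0 //.
by rewrite addr_ge0 ?subr_ge0 // mulr_ge0 ?divr_ge0 // addr_ge0 ?expR_ge0.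
Qed.

End Labels.

(** * Clone decomposition of densities *)

Section Densities.
Context d (T : measurableType d) (R : realType) (mu : {measure set T -> \bar R}).
Implicit Types f g : T -> R.
Local Notation int f := (mu.-integrable setT (EFin \o f)).
Local Notation J f := (Rintegral mu setT f).

Lemma integrable_addr f g : int f -> int g -> int (fun x => f x + g x).
Proof. by move=> hf hg; exact: (integrableD _ hf hg). Qed.

Lemma integrable_subr f g : int f -> int g -> int (fun x => f x - g x).
Proof. by move=> hf hg; exact: (integrableB _ hf hg). Qed.

Lemma integrable_scaler (k : R) f : int f -> int (fun x => k * f x).
Proof. by move=> hf; exact: (integrableZl _ k hf). Qed.

Lemma integrable_measurable_fun f : int f -> measurable_fun setT f.
Proof. by move=> h; apply/measurable_EFinP; exact: measurable_int h. Qed.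

Lemma integrable_dominated f g : measurable_fun setT f -> (forall x, `|f x| <= `|g x|) ->
  int g -> int f.
Proof.
move=> mf fg; apply: le_integrable => //; first exact/measurable_EFinP.
by move=> x _; rewrite /= lee_fin.
Qed.

Lemma integrable_maxr0 f : int f -> int (fun x => Num.max (f x) 0).
Proof.
move=> hf; apply: (integrable_dominated _ _ hf).
  by apply: measurable_maxr => //; exact: integrable_measurable_fun.
move=> x; rewrite /Order.max; case: ifP => _; rewrite ?normr0 //.
Qed.

Lemma integrable_mul_unit (F : T -> R) f : measurable_fun setT F -> (forall x, 0 <= F x <= 1) ->
  int f -> int (fun x => F x * f x).
Proof.
move=> mF F01 hf; apply: (integrable_dominated _ _ hf).
  by apply: measurable_funM => //; exact: integrable_measurable_fun.
move=> x; have /andP[F0 F1] := F01 x.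
by rewrite normrM ler_piMl // ger0_norm.
Qed.

Lemma integrable_sumr (I : Type) (s : seq I) (h : I -> T -> R) :
  (forall i, int (h i)) -> int (fun x => \sum_(i <- s) h i x).
Proof.
move=> hi; have := integrable_sum measurableT s (P := xpredT) (fun i _ => hi i).
by apply: eq_integrable => // x _ /=; rewrite sumEFin.
Qed.

Lemma Rintegral_le f g : int f -> int g -> (forall x, f x <= g x) -> J f <= J g.
Proof. by move=> hf hg fg; apply: le_Rintegral. Qed.

Lemma Rintegral_nonneg f : (forall x, 0 <= f x) -> 0 <= J f.
Proof. by move=> f0; apply: Rintegral_ge0. Qed.

Lemma Rintegral_sumr (I : Type) (s : seq I) (h : I -> T -> R) : (forall i, int (h i)) ->
  J (fun x => \sum_(i <- s) h i x) = \sum_(i <- s) J (h i).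
Proof.
move=> hi; elim: s => [|i s IH].
  by rewrite big_nil /Rintegral; under eq_integral do rewrite big_nil; rewrite integral0.
rewrite big_cons -IH -RintegralD //; last exact: integrable_sumr.
by apply: eq_Rintegral => x _; rewrite big_cons.
Qed.

(* Truncating [f] at [e g] and [g] at [e f] makes the pair pointwise comparable; the heavier of the
   two truncations is then moved towards its lower bound until both have the same mass. *)
Lemma comparable_truncation (e dl : R) f g : 1 < e ->
  (forall x, 0 <= f x) -> (forall x, 0 <= g x) -> int f -> int g -> J f = 1 -> J g = 1 ->
  J (fun x => Num.max (f x - e * g x) 0) <= dl ->
  J (fun x => Num.max (g x - e * f x) 0) <= dl ->
  exists f' g', [/\ int f' /\ int g',
    forall x, 0 <= f' x <= f x /\ 0 <= g' x <= g x,
    forall x, f' x <= e * g' x /\ g' x <= e * f' x,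
    J f' = J g' & 1 - dl <= J f'].
Proof.
move=> e1 f0 g0 hf hg Jf Jg fdl gdl.
pose tr (a b : T -> R) x := a x - Num.max (a x - e * b x) 0.
have trE a b : forall x, tr a b x = Num.min (a x) (e * b x).
  by move=> x; rewrite /tr; case: (leP (a x) (e * b x)) => h;
    [rewrite max_r ?subr0 // subr_le0 | rewrite max_l ?subr_ge0 ?ltW //; ring].
have tri a b : int a -> int b -> int (tr a b).
  move=> ha hb; apply: integrable_subr => //; apply: integrable_maxr0.
  by apply: integrable_subr => //; exact: integrable_scaler.
have trJ a b : int a -> int b -> J a = 1 ->
    J (fun x => Num.max (a x - e * b x) 0) <= dl -> 1 - dl <= J (tr a b).
  move=> ha hb Ja h; rewrite RintegralB // ?Ja; first by rewrite lerD2l lerN2.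
  by apply: integrable_maxr0; apply: integrable_subr => //; exact: integrable_scaler.
wlog lefg : f g f0 g0 hf hg Jf Jg fdl gdl / J (tr f g) <= J (tr g f).
  move=> W; have [l|l] := leP (J (tr f g)) (J (tr g f)); first exact: W.
  have [|g' [f' [[ig' iF'] b c Jfg Jdl]]] := W g f g0 f0 hg hf Jg Jf gdl fdl; first exact: ltW.
  exists f', g'; split=> //.
  - by move=> x; have [] := b x.
  - by move=> x; have [] := c x.
  - by rewrite -Jfg.
have if1 := tri f g hf hg; have ig1 := tri g f hg hf.
(* The weight for which the combination of e^-1 [tr f g] (weight t) and [tr g f] (weight 1 - t) has
   the same mass as [tr f g]. *)
pose t := (J (tr g f) - J (tr f g)) / (J (tr g f) - e^-1 * J (tr f g)).
have e0 : 0 < e by lra.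
have ie1 : e^-1 <= 1 by rewrite invf_le1 // ltW.
have ie0 : 0 < e^-1 by rewrite invr_gt0.
have Jf1 : 0 <= J (tr f g).
  by apply: Rintegral_nonneg => x; rewrite trE le_min f0 mulr_ge0 // ltW.
have den : J (tr g f) - J (tr f g) <= J (tr g f) - e^-1 * J (tr f g).
  by rewrite lerD2l lerN2 ler_piMl.
have t0 : 0 <= t by rewrite /t divr_ge0 ?subr_ge0 //; lra.
have t1 : t <= 1.
  rewrite /t; have [->|dn] := eqVneq (J (tr g f) - e^-1 * J (tr f g)) 0.
    by rewrite invr0 mulr0.
  by rewrite ler_pdivrMr ?mul1r // lt_def dn; lra.
exists (tr f g), (fun x => t * (e^-1 * tr f g x) + (1 - t) * tr g f x).
have bnd x : e^-1 * tr f g x <= tr g f x /\ tr g f x <= e * tr f g x.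
  rewrite !trE; split.
    rewrite le_min; apply/andP; split.
      by rewrite -(ler_pM2l e0) mulVKf ?gt_eqF // ge_min lexx orbT.
    rewrite -(ler_pM2l e0) mulVKf ?gt_eqF // ge_min; apply/orP; left.
    have fx := f0 x.
    have h1 := ler_wpM2r fx (ltW e1); have h2 := ler_wpM2l (ltW e0) h1.
    by rewrite mul1r in h1; rewrite mul1r in h2; lra.
  rewrite minr_pMr ?(ltW e0) // le_min !ge_min lexx orbT /=.
  apply/orP; left.
  have gx := g0 x.
  have h1 := ler_wpM2r gx (ltW e1); have h2 := ler_wpM2l (ltW e0) h1.
  by rewrite mul1r in h1; rewrite mul1r in h2; lra.
have tr0 x : 0 <= tr f g x <= f x by rewrite trE le_min f0 mulr_ge0 ?(ltW e0) //= ge_min lexx.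
have tr0' x : 0 <= tr g f x <= g x by rewrite trE le_min g0 mulr_ge0 ?(ltW e0) //= ge_min lexx.
have sub x : e^-1 * tr f g x <= t * (e^-1 * tr f g x) + (1 - t) * tr g f x <= tr g f x.
  have [b1 _] := bnd x.
  have := ler_wpM2l t0 b1; have t1' : 0 <= 1 - t by lra.
  have := ler_wpM2l t1' b1; lra.
have it1 := integrable_scaler t (integrable_scaler e^-1 if1).
have it2 := integrable_scaler (1 - t) ig1.
split.
- by split => //; exact: integrable_addr.
- move=> x; split=> //; have /andP[s1 s2] := sub x; have /andP[u1 u2] := tr0' x.
  have /andP[v1 v2] := tr0 x.
  by rewrite (le_trans s2 u2) andbT (le_trans _ s1) // mulr_ge0 // ltW.
- move=> x; have [b1 b2] := bnd x; have /andP[s1 s2] := sub x; split.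
    by rewrite -(ler_pM2l ie0) mulKf ?gt_eqF.
  exact: le_trans s2 b2.
- rewrite (RintegralD measurableT it1 it2) (RintegralZl t measurableT (integrable_scaler e^-1 if1)).
  rewrite (RintegralZl e^-1 measurableT if1) (RintegralZl (1 - t) measurableT ig1).
  (* With a zero denominator t is only a default value, but then both truncations have mass 0 and
     the equality of masses is trivial. *)
  have [dn|dn] := eqVneq (J (tr g f) - e^-1 * J (tr f g)) 0; last first.
    have := divfK dn (J (tr g f) - J (tr f g)); rewrite -/t; lra.
  have Jf0 : J (tr f g) * (1 - e^-1) <= 0 by lra.
  have e1' : 0 < 1 - e^-1 by rewrite subr_gt0 invf_lt1.
  have Jf00 : J (tr f g) = 0.
    by apply/eqP; rewrite eq_le Jf1 andbT -(ler_pM2r e1') mul0r.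
  have Jg0 : J (tr g f) = 0 by move: dn; rewrite Jf00; lra.
  by rewrite Jf00 Jg0; ring.
- exact: trJ.
Qed.

(** The two error directions have separate budgets: the first run is estimated from above at cost a,
    the second, which enters with a minus sign, from below at cost b. *)
Definition close_density (a b : R) f g := exists ep en : T -> R,
  [/\ int ep /\ int en, forall x, 0 <= ep x /\ 0 <= en x,
      forall x, f x = g x + (ep x - en x), J ep <= a & J en <= b].

Lemma close_density_integral (a b : R) f g (F : T -> R) : close_density a b f g -> int g ->
  measurable_fun setT F -> (forall x, 0 <= F x <= 1) ->
  J (fun x => F x * g x) - b <= J (fun x => F x * f x) <= J (fun x => F x * g x) + a.
Proof.
move=> [ep [en [[ip ie] pos E Ja Jb]]] ig mF F01.
have iF h : int h -> int (fun x => F x * h x) by exact: integrable_mul_unit.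
have le1 h : int h -> (forall x, 0 <= h x) -> 0 <= J (fun x => F x * h x) <= J h.
  move=> ih h0; apply/andP; split.
    by apply: Rintegral_nonneg => x; rewrite mulr_ge0 //; have /andP[] := F01 x.
  apply: Rintegral_le; [exact: iF|exact: ih|] => x.
  by rewrite ler_piMl //; have /andP[] := F01 x.
have /andP[p0 p1] := le1 _ ip (fun x => proj1 (pos x)).
have /andP[e0 e1] := le1 _ ie (fun x => proj2 (pos x)).
have -> : J (fun x => F x * f x) =
    J (fun x => F x * g x) + (J (fun x => F x * ep x) - J (fun x => F x * en x)).
  rewrite -RintegralB -?RintegralD; try by [|exact: iF|apply: integrable_subr; exact: iF].
  by apply: eq_Rintegral => x _; rewrite E; ring.
lra.
Qed.

(** Truncate f and g to a comparable pair f', g' and solve the 2 x 2 mixture system for the shared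
    densities; comparability makes the solutions nonnegative. Their sum is f' + g', and e^-1/2 (f' +
    g') lies below every r k up to small mass, so this clone part can be split off from r k. *)
Lemma clone_densities (K : Type) (e dl : R) f g (r : K -> T -> R) :
  1 < e -> 0 <= dl ->
  (forall x, 0 <= f x) -> (forall x, 0 <= g x) ->
  int f -> int g -> (forall k, int (r k)) ->
  J f = 1 -> J g = 1 -> (forall k, J (r k) = 1) ->
  J (fun x => Num.max (f x - e * g x) 0) <= dl ->
  J (fun x => Num.max (g x - e * f x) 0) <= dl ->
  (forall k, J (fun x => Num.max (f x - e * r k x) 0) <= dl) ->
  (forall k, J (fun x => Num.max (g x - e * r k x) 0) <= dl) ->
  exists m : bool + K -> T -> R,
  [/\ forall l, [/\ int (m l), forall x, 0 <= m l x & J (m l) <= 1],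
      forall b : bool, close_density ((1 + e^-1) * dl) (e^-1 * dl) (if b then g else f)
        (fun x => e / (e + 1) * m (inl b) x + (1 - e / (e + 1)) * m (inl (~~ b)) x) &
      forall k, close_density ((1 + e^-1) * dl) (e^-1 * dl) (r k)
        (fun x => e^-1 / 2 * (m (inl false) x + m (inl true) x) + (1 - e^-1) * m (inr k) x)].
Proof.
move=> e1 dl0 f0 g0 hf hg hr Jf Jg Jr fg gf fr gr.
have [f' [g' [[if' ig'] bnd cmp Jfg' Jdl]]] := comparable_truncation e1 f0 g0 hf hg Jf Jg fg gf.
have e0 : 0 < e by lra.
have en0 : e != 0 by rewrite gt_eqF.
have em1 : 0 < e - 1 by lra.
have em0 : e - 1 != 0 by rewrite gt_eqF.
have ep0 : e + 1 != 0 by rewrite gt_eqF //; lra.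
have p0 : 0 < e^-1 by rewrite invr_gt0.
have p1 : 0 < 1 - e^-1 by rewrite subr_gt0 invf_lt1.
have Jf1 : J f' <= 1 by rewrite -Jf; apply: Rintegral_le => // x; have [/andP[]] := bnd x.
have pd0 : 0 <= e^-1 * dl by rewrite mulr_ge0 // ltW.
pose q (b : bool) := if b then g' else f'.
have iq b : int (q b) by case: b.
have Jq b : J (q b) = J f' by case: b.
(* What remains of r k after removing its clone part. Its positive part, normalised, is the own law
   of user k; its negative part is an error. *)
pose nu k x := r k x - e^-1 / 2 * (f' x + g' x).
have inu k : int (nu k).
  by apply: integrable_subr => //; apply: integrable_scaler; exact: integrable_addr.
pose vp k x := Num.max (nu k x) 0.
pose vn k x := Num.max (- nu k x) 0.
have ivp k : int (vp k) by exact: integrable_maxr0.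
have ivn k : int (vn k).
  have h := integrable_scaler (-1) (inu k).
  have := integrable_maxr0 h; apply: eq_integrable => // x _.
  by rewrite /= /vn mulN1r.
have nuE k x : nu k x = vp k x - vn k x.
  by rewrite /vp /vn; case: (leP (nu k x) 0) => h;
    [rewrite max_l ?oppr_ge0 //; ring | rewrite max_r ?oppr_le0 ?ltW // subr0].
have Jnu k : J (nu k) = 1 - e^-1 * J f'.
  rewrite /nu RintegralB // ?Jr; last by apply: integrable_scaler; exact: integrable_addr.
  rewrite (RintegralZl _ measurableT (integrable_addr if' ig')) (RintegralD measurableT if' ig') -Jfg'.
  by congr (1 - _); field.
have Jv k : J (vp k) = 1 - e^-1 * J f' + J (vn k).
  have : J (nu k) = J (vp k) - J (vn k).
    rewrite -(RintegralB measurableT (ivp k) (ivn k)); apply: eq_Rintegral => x _; exact: nuE.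
  by rewrite Jnu => ->; ring.
have Jvn0 k : 0 <= J (vn k) by apply: Rintegral_nonneg => x; rewrite /vn le_max lexx orbT.
(* Pointwise, the negative part is at most e^-1/2 times the sum of the excesses of f and of g over e
   r k, each of mass at most dl. *)
have Jvn k : J (vn k) <= e^-1 * dl.
  have i1 : int (fun x => Num.max (f x - e * r k x) 0).
    by apply: integrable_maxr0; apply: integrable_subr => //; exact: integrable_scaler.
  have i2 : int (fun x => Num.max (g x - e * r k x) 0).
    by apply: integrable_maxr0; apply: integrable_subr => //; exact: integrable_scaler.
  apply: (@le_trans _ _ (J (fun x => e^-1 / 2 * (Num.max (f x - e * r k x) 0 +
      Num.max (g x - e * r k x) 0)))).
    apply: Rintegral_le => //; first by apply: integrable_scaler; exact: integrable_addr.
    move=> x; rewrite /vn ge_max; apply/andP; split; last first.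
      by rewrite mulr_ge0 ?divr_ge0 ?(ltW p0) // addr_ge0 // le_max lexx orbT.
    have a1 : f x - e * r k x <= Num.max (f x - e * r k x) 0 by rewrite le_max lexx.
    have a2 : g x - e * r k x <= Num.max (g x - e * r k x) 0 by rewrite le_max lexx.
    have [/andP[_ b1] /andP[_ b2]] := bnd x.
    have a3 : f' x + g' x - 2 * (e * r k x) <= Num.max (f x - e * r k x) 0 +
      Num.max (g x - e * r k x) 0 by lra.
    have h2 : 0 <= e^-1 / 2 by rewrite divr_ge0 // ltW.
    apply: le_trans (ler_wpM2l h2 a3).
    have -> : e^-1 / 2 * (f' x + g' x - 2 * (e * r k x)) =
      e^-1 / 2 * (f' x + g' x) - r k x by field.
    by rewrite /nu; lra.
  rewrite (RintegralZl _ measurableT (integrable_addr i1 i2)) (RintegralD measurableT i1 i2).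
  have := ler_wpM2l (ltW p0) (fr k); have := ler_wpM2l (ltW p0) (gr k); lra.
have pJ1 : e^-1 * J f' <= e^-1 by rewrite ler_piMr // ltW.
have pJ2 : e^-1 * (1 - dl) <= e^-1 * J f' by apply: ler_wpM2l => //; exact: ltW.
have Jvp0 k : 1 - e^-1 <= J (vp k) by rewrite Jv; have := Jvn0 k; lra.
have Jvp1 k : 0 < J (vp k) by have := Jvp0 k; lra.
(* The [inl] cases invert q_b = e/(e+1) m_b + 1/(e+1) m_(~~ b). *)
pose m (l : bool + K) : T -> R := match l with
  | inl b => fun x => (e - 1)^-1 * (e * q b x - q (~~ b) x)
  | inr k => fun x => (J (vp k))^-1 * vp k x end.
have im l : int (m l).
  case: l => [b|k]; apply: integrable_scaler => //.
  by apply: integrable_subr => //; exact: integrable_scaler.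
have Dvp k : 1 - e^-1 <= J (vp k) -> (1 - e^-1) * (J (vp k))^-1 <= 1.
  by move=> h; rewrite ler_pdivrMr ?mul1r.
exists m; split.
- move=> l; split=> //.
    case: l => [b|k] x /=; last first.
      by rewrite mulr_ge0 ?invr_ge0 ?(ltW (Jvp1 k)) // le_max lexx orbT.
    rewrite mulr_ge0 ?invr_ge0 ?(ltW em1) // subr_ge0.
    by have [c1 c2] := cmp x; case: b => /=.
  case: l => [b|k]; rewrite /m.
    have i1 := integrable_scaler e (iq b).
    rewrite (RintegralZl _ measurableT (integrable_subr i1 (iq (~~ b))))
      (RintegralB measurableT i1 (iq (~~ b))).
    rewrite (RintegralZl _ measurableT (iq b)) !Jq.
    by have -> : (e - 1)^-1 * (e * J f' - J f') = J f' by field.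
  by rewrite (RintegralZl _ measurableT (ivp k)) mulVf ?gt_eqF.
- move=> b; exists (fun x => (if b then g else f) x - q b x), (fun=> 0).
  have iJ0 : int (fun=> 0 : R) by exact: integrable0.
  split.
  + by split=> //; apply: integrable_subr => //; case: (b).
  + by move=> x; rewrite subr_ge0; have [/andP[_ b1] /andP[_ b2]] := bnd x; case: (b).
  + move=> x; rewrite /m negbK.
    rewrite (_ : _ + _ * ((e - 1)^-1 * _) = q b x); last by field; rewrite ?ep0 ?em0.
    by ring.
  + rewrite RintegralB //; last by case: (b).
    rewrite Jq (_ : J _ = 1); last by case: (b).
    lra.
  + by rewrite /Rintegral integral0.
(* The own law gets weight exactly 1 - e^-1, so the surplus mass J (vp k) - (1 - e^-1) of the
   positive part is an upper error. It equals e^-1 (1 - J f') + J (vn k) <= 2 e^-1 dl, within the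
   budget as e^-1 <= 1. *)
- move=> k; exists (fun x => (1 - (1 - e^-1) / J (vp k)) * vp k x), (vn k).
  split.
  + by split=> //; exact: integrable_scaler.
  + move=> x; split; last by rewrite le_max lexx orbT.
    by rewrite mulr_ge0 ?subr_ge0 ?Dvp // le_max lexx orbT.
  + move=> x; rewrite /m /q /=.
    have -> : r k x = vp k x - vn k x + e^-1 / 2 * (f' x + g' x) by rewrite -nuE /nu; ring.
    by field; rewrite ?em0 ?en0 gt_eqF.
  + rewrite (RintegralZl _ measurableT (ivp k)) mulrBl mul1r divfK ?gt_eqF // Jv.
    have := Jvn k; have := ler_wpM2r dl0 (ltW p1); lra.
  + exact: Jvn.
Qed.

End Densities.

(** * Common densities of finitely many laws *)

Lemma finite_measureP d (T : measurableType d) (R : realType)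
    (m : {measure set T -> \bar R}) : (m setT < +oo)%E ->
  exists nu : {finite_measure set T -> \bar R}, m = nu.
Proof.
move=> mT.
have fin := lty_fin_num_fun mT.
have sig : sigma_finite setT m by apply: fin_num_fun_sigma_finite; rewrite ?measure0.
pose H1 := isFinite.Build _ _ _ _ fin.
pose H2 := isSFinite.Build _ _ _ _ (sfinite_measure_sigma_finite sig).
pose H3 := isSigmaFinite.Build _ _ _ _ sig.
pose nu := HB.pack_for (FiniteMeasure.type T R) (Measure.sort m) H1 H2 H3.
by exists nu; exact: eq_measure.
Qed.

(** The output space carries no reference measure; the sum of the finitely many laws dominates each
    of them, and Radon-Nikodym applies. *)
Lemma common_densities d (T : measurableType d) (R : realType) (I : finType)
    (M : I -> {measure set T -> \bar R}) :
  (forall i, M i setT = 1%E) ->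
  exists (mu : {measure set T -> \bar R}) (r : I -> T -> R),
  [/\ forall i x, 0 <= r i x,
      forall i, mu.-integrable setT (EFin \o r i) &
      forall i (F : T -> R), (forall x, 0 <= F x) -> measurable_fun setT F ->
        (\int[M i]_x (F x)%:E = \int[mu]_x (F x * r i x)%:E)%E].
Proof.
move=> M1.
(* [msum] takes a family indexed by [nat], so [I] is enumerated and the family is continued by the
   zero measure. *)
pose m k : {measure set T -> \bar R} :=
  match (insub k : option 'I_#|I|) with Some j => M (enum_val j) | None => mzero end.
pose mu0 : {measure set T -> \bar R} := msum m #|I|.
have mu0T : (mu0 setT < +oo)%E.
  rewrite /mu0 /= /msum; apply: lte_sum_pinfty => i _.
  by rewrite /m valK M1 ltry.
have [mu mu0E] := finite_measureP mu0T.
have MT i : (M i setT < +oo)%E by rewrite M1 ltry.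
have [nu nuE] := choice (fun i => finite_measureP (MT i)).
have nle i A : (nu i A <= mu A)%E.
  rewrite -(congr1 (fun v : {measure set T -> \bar R} => v A) (nuE i)).
  rewrite -(congr1 (fun v : {measure set T -> \bar R} => v A) mu0E).
  rewrite /= /msum (bigD1 (enum_rank i)) //= {1}/m valK enum_rankK.
  by rewrite leeDl // sume_ge0.
have dom i : nu i `<< mu.
  move=> A A0 B mB BA; apply/eqP; rewrite eq_le measure_ge0 andbT.
  by rewrite -(A0 _ mB BA) nle.
pose rn i := Radon_Nikodym_SigmaFinite.f (nu i) mu.
have rnE i x : rn i x = (fine (rn i x))%:E.
  by rewrite fineK //; exact: Radon_Nikodym_SigmaFinite.f_fin_num.
exists mu, (fun i x => fine (rn i x)); split.
- by move=> i x; rewrite fine_ge0 //; exact: Radon_Nikodym_SigmaFinite.f_ge0.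
- move=> i; have := Radon_Nikodym_SigmaFinite.f_integrable (dom i).
  by apply: eq_integrable => // x _; rewrite /= -rnE.
- move=> i F F0 mF.
  have := @Radon_Nikodym_SigmaFinite.change_of_variables _ _ _ (nu i) mu (dom i)
    (EFin \o F) setT.
  rewrite nuE; move=> <- //; last by apply/measurable_EFinP.
  by apply: eq_integral => x _; rewrite EFinM -rnE.
Qed.

Section Step.
Context d (T : measurableType d) (R : realType) (mu : {measure set T -> \bar R}).
Local Notation int f := (mu.-integrable setT (EFin \o f)).
Local Notation J f := (Rintegral mu setT f).

Lemma density_integral (M : {measure set T -> \bar R}) (r F : T -> R) :
  int r ->
  (forall F : T -> R, (forall x, 0 <= F x) -> measurable_fun setT F ->
     (\int[M]_x (F x)%:E = \int[mu]_x (F x * r x)%:E)%E) ->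
  (forall x, 0 <= F x <= 1) -> measurable_fun setT F ->
  (\int[M]_x (F x)%:E = (J (fun x => F x * r x))%:E)%E.
Proof.
move=> ir h F01 mF; rewrite h //; last by move=> x; have /andP[] := F01 x.
rewrite /Rintegral fineK //; apply: integrable_fin_num => //.
exact: (integrable_mul_unit mF F01 ir).
Qed.

(** The event where r > e s is extremal: on it r - e s is its own positive part, which vanishes off
    it. Testing the privacy inequality on this event suffices. *)
Lemma excess_mass (M N : {measure set T -> \bar R}) (r s : T -> R) (e dl : R) :
  int r -> int s ->
  (forall F : T -> R, (forall x, 0 <= F x) -> measurable_fun setT F ->
     (\int[M]_x (F x)%:E = \int[mu]_x (F x * r x)%:E)%E) ->
  (forall F : T -> R, (forall x, 0 <= F x) -> measurable_fun setT F ->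
     (\int[N]_x (F x)%:E = \int[mu]_x (F x * s x)%:E)%E) ->
  (forall E, measurable E -> (M E <= e%:E * N E + dl%:E)%E) ->
  J (fun x => Num.max (r x - e * s x) 0) <= dl.
Proof.
move=> ir is_ hr hs MN.
pose E := [set x | 0 < r x - e * s x]%classic.
have ires : int (fun x => r x - e * s x) by apply: integrable_subr => //; exact: integrable_scaler.
have mE : measurable E.
  rewrite (_ : E = setT `&` (fun x => r x - e * s x) @^-1` `]0, +oo[)%classic; last first.
    by apply/seteqP; split=> x /=; rewrite in_itv /= andbT; [|case].
  exact: (integrable_measurable_fun ires).
have mI : measurable_fun setT (\1_E : T -> R) by exact: measurable_indic.
have I01 x : 0 <= (\1_E x : R) <= 1 by rewrite indicE; case: (_ \in _); rewrite ?lexx ?ler01.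
have ME (L : {measure set T -> \bar R}) : L E = (\int[L]_x (\1_E x)%:E)%E.
  by rewrite integral_indic // setIT.
have := MN E mE; rewrite !ME (density_integral ir hr) // (density_integral is_ hs) //.
rewrite lee_fin.
have i1 := integrable_mul_unit mI I01 ir; have i2 := integrable_mul_unit mI I01 is_.
have -> : J (fun x => Num.max (r x - e * s x) 0) =
    J (fun x => \1_E x * r x) - e * J (fun x => \1_E x * s x).
  rewrite -(RintegralZl e measurableT i2) -(RintegralB measurableT i1 (integrable_scaler e i2)).
  apply: eq_Rintegral => x _.
  rewrite indicE; case: (boolP (x \in E)) => xE /=.
    by rewrite max_l; [ring | move: xE; rewrite inE => /ltW].
  rewrite max_r; first by ring.
  by rewrite leNgt; apply: contraNN xE; rewrite inE.
lra.
Qed.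

End Step.

(** * One step of the protocol at a fixed history *)

Section StepBound.
Context d (T : measurableType d) (R : realType) (n : nat) (u0 : 'I_n).
Local Notation label := (bool + 'I_n)%type.

(** [s] tells the two runs apart, [F s pi] is the value of continuing and [j] the current time. Each
    step law is replaced by its mixture of label densities; regrouped by label, the sum over
    permutations is bounded pointwise by [G l]. The last sum collects the [close_density] errors. *)
Lemma step_bound (M : bool -> 'I_n -> {measure set T -> \bar R}) (e dl : R)
    (c : bool -> 'S_n -> R) (F : bool -> 'S_n -> T -> R) (G : label -> R) (j : 'I_n) :
  let wt := mixed_weight u0 e^-1 (e / (e + 1)) in
  1 < e -> 0 <= dl ->
  (forall s u, M s u setT = 1%E) ->
  (forall s u s' u' E, measurable E -> (M s u E <= e%:E * M s' u' E + dl%:E)%E) ->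
  (forall u, u != u0 -> M true u = M false u) ->
  (forall s pi, 0 <= c s pi) ->
  (forall s pi, measurable_fun setT (F s pi)) ->
  (forall s pi x, 0 <= F s pi x <= 1) ->
  (forall l, 0 <= G l) ->
  (forall l x, \sum_pi (c false pi * wt false (pi j) l * F false pi x -
                        c true pi * wt true (pi j) l * F true pi x) <= G l) ->
  \sum_pi (c false pi * fine (\int[M false (pi j)]_x (F false pi x)%:E)%E -
           c true pi * fine (\int[M true (pi j)]_x (F true pi x)%:E)%E) <=
  \sum_l G l + \sum_pi (c false pi * ((1 + e^-1) * dl) + c true pi * (e^-1 * dl)).
Proof.
move=> wt e1 dl0 M1 MM Mu c0 mF F01 G0 FG.
have [mu [r [r0 ir hr]]] := @common_densities _ T R (bool * 'I_n)%type
  (fun i => M i.1 i.2) (fun i => M1 i.1 i.2).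
(* Two densities of the same law need not agree pointwise, so a user other than [u0] is given the
   density of run [false] in both runs. *)
pose rr (s : bool) u := r (s && (u == u0), u).
have ME s u : M s u = M (s && (u == u0)) u.
  by case: s => //=; have [->|/Mu] := eqVneq u u0.
have irr s u := ir (s && (u == u0), u).
have hrr s u (H : T -> R) : (forall x, 0 <= H x <= 1) -> measurable_fun setT H ->
    (\int[M s u]_x (H x)%:E = (Rintegral mu setT (fun x => H x * rr s u x))%:E)%E.
  move=> H01 mH; rewrite ME.
  exact: (density_integral (irr s u) (hr (s && (u == u0), u)) H01 mH).
have J1 i : Rintegral mu setT (r i) = 1.
  have h : (\int[M i.1 i.2]_x (1 : R)%:E = (Rintegral mu setT (fun x => 1 * r i x))%:E)%E.
    by apply: (density_integral (ir i) (hr i)) => // x; rewrite ler01 lexx.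
  move: h; rewrite integral_cst // mul1e M1 => /(congr1 fine) /= ->.
  by apply: eq_Rintegral => x _; rewrite mul1r.
have exc i i' : Rintegral mu setT (fun x => Num.max (r i x - e * r i' x) 0) <= dl.
  apply: (excess_mass (ir i) (ir i') (hr i) (hr i')) => E mE; exact: MM.
have [m [mP mb mk]] := clone_densities (K := 'I_n) (r := fun k => r (false, k)) e1 dl0
  (r0 (false, u0)) (r0 (true, u0)) (ir (false, u0)) (ir (true, u0)) (fun k => ir _)
  (J1 (false, u0)) (J1 (true, u0)) (fun k => J1 _) (exc _ _) (exc _ _)
  (fun k => exc _ _) (fun k => exc _ _).
have im l : mu.-integrable setT (EFin \o m l) by have [] := mP l.
have close s u : close_density mu ((1 + e^-1) * dl) (e^-1 * dl) (rr s u)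
    (fun x => \sum_l wt s u l * m l x).
  rewrite /rr /wt /mixed_weight; have [->|uu0] := eqVneq u u0.
    rewrite andbT; have := mb s.
    rewrite (_ : (if s then _ else _) = r (s, u0)); last by case: (s).
    congr close_density; apply/funext => x; rewrite sum_label big1 => [|v _].
      by case: s => /=; ring.
    by rewrite !mulr0 addr0 mul0r.
  rewrite andbF; have := mk u; congr close_density; apply/funext => x.
  by rewrite (sum_clone_weight _ (fun l => m l x)).
have isum s u : mu.-integrable setT (EFin \o (fun x => \sum_l wt s u l * m l x)).
  by apply: integrable_sumr => l; exact: integrable_scaler.
have JF s pi : Rintegral mu setT (fun x => F s pi x * \sum_l wt s (pi j) l * m l x) =
    \sum_l wt s (pi j) l * Rintegral mu setT (fun x => F s pi x * m l x).
  under [RHS]eq_bigr => l _ do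
    rewrite -(RintegralZl _ measurableT (integrable_mul_unit (mF s pi) (F01 s pi) (im l))).
  rewrite -Rintegral_sumr; last first.
    by move=> l; exact: (integrable_scaler _ (integrable_mul_unit (mF s pi) (F01 s pi) (im l))).
  by apply: eq_Rintegral => x _; rewrite mulr_sumr; apply: eq_bigr => l _; ring.
apply: (@le_trans _ _ (\sum_pi (\sum_l (
    c false pi * wt false (pi j) l * Rintegral mu setT (fun x => F false pi x * m l x) -
    c true pi * wt true (pi j) l * Rintegral mu setT (fun x => F true pi x * m l x)) +
    (c false pi * ((1 + e^-1) * dl) + c true pi * (e^-1 * dl))))).
  apply: ler_sum => pi _; rewrite !hrr //=.
  have /andP[_ h1] := close_density_integral (close false (pi j)) (isum _ _)
    (mF false pi) (F01 false pi).
  have /andP[h2 _] := close_density_integral (close true (pi j)) (isum _ _)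
    (mF true pi) (F01 true pi).
  rewrite !JF in h1 h2.
  rewrite sumrB; under eq_bigr do rewrite -mulrA.
  under [X in _ <= _ - X + _]eq_bigr do rewrite -mulrA.
  rewrite -!mulr_sumr.
  have := ler_wpM2l (c0 false pi) h1; have := ler_wpM2l (c0 true pi) h2.
  rewrite mulrBr mulrDr; lra.
rewrite big_split /= lerD2r exchange_big /=; apply: ler_sum => l _.
have [_ m0 m1] := mP l.
have ih s pi := integrable_mul_unit (mF s pi) (F01 s pi) (im l).
have ik s pi := integrable_scaler (c s pi * wt s (pi j) l) (ih s pi).
under eq_bigr do
  rewrite -(RintegralZl _ measurableT (ih _ _)) -(RintegralZl _ measurableT (ih _ _)).
under eq_bigr do rewrite -(RintegralB measurableT (ik _ _) (ik _ _)).
rewrite -Rintegral_sumr; last by move=> pi; exact: (integrable_subr (ik _ _) (ik _ _)).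
(* The density [m l] depends neither on the run nor on the permutation, so it factors out of the
   whole sum; its mass is at most 1. *)
apply: (@le_trans _ _ (Rintegral mu setT (fun x => G l * m l x))).
  apply: Rintegral_le.
  - by apply: integrable_sumr => pi; exact: (integrable_subr (ik _ _) (ik _ _)).
  - exact: integrable_scaler.
  - move=> x; apply: le_trans (ler_wpM2r (m0 x) (FG l x)).
    by rewrite mulr_suml; apply: ler_sum => pi _; lra.
by rewrite (RintegralZl _ measurableT (im l)) ler_piMr.
Qed.

End StepBound.

(** * Backward induction over the protocol *)

Lemma sum_tuple_cons (R : nmodType) (L : finType) (m : nat) (f : m.+1.-tuple L -> R) :
  \sum_w f w = \sum_l \sum_(w : m.-tuple L) f [tuple of l :: w].
Proof.
rewrite pair_bigA /= (reindex (fun q : L * m.-tuple L => [tuple of q.1 :: q.2])) //=.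
exists (fun w : m.+1.-tuple L => (thead w, [tuple of behead w])) => [[l w] _|w _] /=.
  by congr pair; apply: val_inj.
by rewrite [RHS]tuple_eta.
Qed.

Section Run.
Variables (R : realType) (D : Type) (dS : nat -> measure_display)
  (S : forall i, measurableType (dS i)) (n : nat)
  (Rz : forall i, D -> R.-pker (hist S i) ~> S i).

Definition test_fun k (g : hist S k -> \bar R) :=
  measurable_fun setT g /\ forall z, (0 <= g z <= 1)%E.

Lemma test_fun_cast k k' (e : k = k') (g : hist S k -> \bar R) :
  test_fun g -> test_fun (eq_rect k (fun k => hist S k -> \bar R) g k' e).
Proof. by case: _ / e. Qed.

Lemma step_law_ord (x : 'I_n -> D) pi (j : 'I_n) (h : hist S j) :
  step_law Rz x pi h = Rz j (x (pi j)) h.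
Proof. by rewrite /step_law valK. Qed.

Lemma test_fun_cont (x : 'I_n -> D) pi m i (g : hist S (m + i) -> \bar R) :
  test_fun g -> test_fun (cont Rz x pi (m := m) g).
Proof.
elim: m i g => [//|m IH] i g gt /=.
have [mG G01] := IH _ _ (test_fun_cast (esym (addnS m i)) gt).
split=> [|h].
  rewrite /step_law; case: insub => [j|].
    pose l : R.-fker (hist S i) ~> (S i) := Rz i (x (pi j)).
    apply: (@measurable_fun_integral_finite_kernel _ _ (hist S i) (S i) R _ l) mG.
    by move=> z; have /andP[] := G01 z.
  under eq_fun do rewrite integral_measure_zero.
  exact: measurable_cst.
apply/andP; split; first by apply: integral_ge0 => z _; have /andP[] := G01 (h, z).
rewrite /step_law; case: insub => [j|]; last by rewrite integral_measure_zero.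
apply: (@le_trans _ _ (\int[Rz i (x (pi j)) h]_z 1)%E); last first.
  by rewrite integral_cst // mul1e prob_kernel.
apply: ge0_le_integral => //.
- by move=> z _; have /andP[] := G01 (h, z).
- exact: (measurableT_comp mG (measurable_pair1 h)).
- by move=> z _; have /andP[] := G01 (h, z).
Qed.

Variables (u0 : 'I_n) (e dl : R) (xs : bool -> 'I_n -> D).
Hypotheses (e1 : 1 < e) (dl0 : 0 <= dl).
Hypothesis xs_eq : forall u, u != u0 -> xs true u = xs false u.
Hypothesis Rz_dp : forall i, (i < n)%N -> forall (h : hist S i) a b E, measurable E ->
  (Rz i a h E <= e%:E * Rz i b h E + dl%:E)%E.

Local Notation label := (bool + 'I_n)%type.
Local Notation wt := (mixed_weight u0 e^-1 (e / (e + 1))).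

(** Times are natural numbers so that the induction can shift them without casts; the value 1
    outside the range is neutral in products. *)
Definition time_weight s (pi : 'S_n) (k : nat) (l : label) : R :=
  if insub k is Some j then wt s (pi j) l else 1.

(** The coefficients [c] are arbitrary so that the induction can absorb label weights: exposing
    label [l] at time i multiplies [c s pi] by its weight. The bound does not mention the history
    [h], which makes it usable as the uniform bound [G l] of [step_bound]. *)
Lemma cont_bound m i (g : hist S (m + i) -> \bar R) (c : bool -> 'S_n -> R) (h : hist S i) :
  (m + i = n)%N -> test_fun g -> (forall s pi, 0 <= c s pi) ->
  \sum_pi (c false pi * fine (cont Rz (xs false) pi g h) -
           c true pi * fine (cont Rz (xs true) pi g h)) <=
  \sum_(w : m.-tuple label) Num.max (\sum_pi (
      c false pi * \prod_(k < m) time_weight false pi (i + k) (tnth w k) -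
      c true pi * \prod_(k < m) time_weight true pi (i + k) (tnth w k))) 0 +
  m%:R * \sum_pi (c false pi * ((1 + e^-1) * dl) + c true pi * (e^-1 * dl)).
Proof.
have e0 : 0 < e by exact: lt_trans ltr01 e1.
have p01 : 0 <= e^-1 <= 1 by rewrite invr_ge0 (ltW e0) invf_le1 // ltW.
have al01 : 0 <= e / (e + 1) <= 1.
  apply/andP; split; first by apply: divr_ge0; lra.
  by rewrite ler_pdivrMr; lra.
have pd0 : 0 <= e^-1 * dl by rewrite mulr_ge0 // invr_ge0 ltW.
have pd1 : 0 <= (1 + e^-1) * dl by rewrite mulr_ge0 // addr_ge0 // invr_ge0 ltW.
elim: m i g c h => [|m IH] i g c h.
  move=> _ [_ g01] c0; rewrite mul0r addr0.
  rewrite [leRHS](bigD1 [tuple]) //= [X in _ + X]big1 ?addr0 => [|w]; last first.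
    by move=> /eqP[]; exact: tuple0.
  under [in leRHS]eq_bigr do rewrite !big_ord0 !mulr1.
  have [v -> /andP[v0 v1]] : exists2 v, g h = v%:E & 0 <= v <= 1.
    have /andP[gh0 gh1] := g01 h.
    have fin : g h \is a fin_num by rewrite ge0_fin_numE // (le_lt_trans gh1) ?ltry.
    by exists (fine (g h)); rewrite ?fineK // -!lee_fin fineK // gh0.
  under eq_bigr do rewrite /= -mulrBl.
  (* At the end of the run the test value [v] is the same for all permutations and both runs, and it
     lies in [0, 1]; hence the positive part. *)
  rewrite -mulr_suml; set s := \sum_pi _.
  have s1 : s <= Num.max s 0 by rewrite le_max lexx.
  have s0 : 0 <= Num.max s 0 by rewrite le_max lexx orbT.
  apply: le_trans (ler_wpM2r v0 s1) _; exact: ler_piMr.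
move=> mi gt c0.
have lt_in : (i < n)%N by rewrite -mi addSnnS leq_addl.
pose j := Ordinal lt_in.
pose g' := eq_rect (m + i)%N.+1 (fun k => hist S k -> \bar R) g _ (esym (addnS m i)).
have gt' : test_fun g' by exact: test_fun_cast.
have contE s pi : cont Rz (xs s) pi g h =
    (\int[Rz i (xs s (pi j)) h]_z cont Rz (xs s) pi g' (h, z))%E.
  by rewrite /= -/g' -(step_law_ord (xs s) pi (j := j)).
pose F s pi z := fine (cont Rz (xs s) pi g' (h, z)).
have FE s pi z : cont Rz (xs s) pi g' (h, z) = (F s pi z)%:E.
  rewrite /F fineK //; have [_ b] := test_fun_cont (xs s) pi gt'.
  have /andP[b0 b1] := b (h, z).
  by rewrite ge0_fin_numE // (le_lt_trans b1) ?ltry.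
pose G l := \sum_(w : m.-tuple label) Num.max (\sum_pi (
      c false pi * wt false (pi j) l * \prod_(k < m) time_weight false pi (i.+1 + k) (tnth w k) -
      c true pi * wt true (pi j) l * \prod_(k < m) time_weight true pi (i.+1 + k) (tnth w k))) 0 +
  m%:R * \sum_pi (c false pi * wt false (pi j) l * ((1 + e^-1) * dl) +
     c true pi * wt true (pi j) l * (e^-1 * dl)).
have w0 s u l : 0 <= wt s u l by exact: mixed_weight_ge0.
have contF s pi : cont Rz (xs s) pi g h = (\int[Rz i (xs s (pi j)) h]_z (F s pi z)%:E)%E.
  by rewrite contE; apply: eq_integral => z _; rewrite FE.
under eq_bigr do rewrite !contF.
have step := @step_bound _ (S i) R n u0 (fun s u => Rz i (xs s u) h) e dl c F G j e1 dl0.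
apply: le_trans (step _ _ _ _ _ _ _ _) _ => {step}.
- by move=> s u; exact: prob_kernel.
- by move=> s u s' u' E mE; exact: Rz_dp.
- by move=> u uu0; rewrite xs_eq.
- exact: c0.
- move=> s pi; have [mG _] := test_fun_cont (xs s) pi gt'.
  apply: measurableT_comp; first exact: fine_measurable.
  exact: (measurableT_comp mG (measurable_pair1 h)).
- move=> s pi z; have [_ b] := test_fun_cont (xs s) pi gt'.
  by have := b (h, z); rewrite FE !lee_fin.
- move=> l; apply: addr_ge0; first by apply: sumr_ge0 => w _; rewrite le_max lexx orbT.
  apply: mulr_ge0 => //; apply: sumr_ge0 => pi _.
  by rewrite addr_ge0 // mulr_ge0 // mulr_ge0.
- move=> l z.
  apply: (IH i.+1 g' (fun s pi => c s pi * wt s (pi j) l) (h, z)) => //.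
  by rewrite addnS.
  by move=> s pi; rewrite mulr_ge0.
rewrite /G big_split /= -addrA; apply: lerD.
  rewrite sum_tuple_cons; apply: ler_sum => l _; apply: ler_sum => w _.
  rewrite le_eqVlt; apply/orP; left; apply/eqP; congr Num.max; apply: eq_bigr => pi _.
  have E s : \prod_(k < m.+1) time_weight s pi (i + k) (tnth [tuple of l :: w] k) =
      wt s (pi j) l * \prod_(k < m) time_weight s pi (i.+1 + k) (tnth w k).
    rewrite big_ord_recl addn0 {1}/time_weight (valK j) tnth0; congr (_ * _).
    by apply: eq_bigr => k _; rewrite tnthS lift0 addnS.
  by rewrite !E !mulrA.
(* The label weights sum to 1, so each of the m remaining steps costs the same error as the current
   one. *)
rewrite -mulr_sumr exchange_big /=.
have -> : \sum_pi \sum_l (c false pi * wt false (pi j) l * ((1 + e^-1) * dl) +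
     c true pi * wt true (pi j) l * (e^-1 * dl)) =
   \sum_pi (c false pi * ((1 + e^-1) * dl) + c true pi * (e^-1 * dl)).
  apply: eq_bigr => pi _; rewrite big_split /= -!mulr_suml -!mulr_sumr.
  by rewrite !sum_mixed_weight !mulr1.
by rewrite -natr1 [leRHS]mulrDl mul1r.
Qed.

End Run.

(** * Amplification *)

(** The moment decreases in X, so it may be estimated at the square-root term [x0], for which x0^2 n
    / e = 64 ln (4 / del). With 1 + y <= expR y the power becomes an exponential, and
    [clone_moment_bound] applies with q = n / e and m = (n - 1) / e. *)
Lemma clone_moment_le (R : realType) (n : nat) (eps0 del : R) :
  let e := expR eps0 in
  let X := 8 * Num.sqrt (e * ln (4 / del)) / Num.sqrt n%:R + 8 * e / n%:R in
  (0 < n)%N -> 0 < eps0 -> 0 < del <= 1 ->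
  eps0 <= ln (n%:R / (16 * ln (2 / del))) ->
  exists2 t, 0 <= t &
    expR t * (1 - e^-1 + e^-1 / 2 * (expR t + expR (- ((1 + X) * t)))) ^+ n.-1 <= del.
Proof.
move=> e X n0 eps00 /andP[d0 d1] heps.
have l2 := ln2_ge_half R.
have lnd : ln del <= 0 by exact: ln_le0.
have L2 : 0 < ln (2 / del) by rewrite ln_div ?posrE //; lra.
have L4 : 0 <= ln (4 / del).
  by rewrite ln_ge0 // ler_pdivlMr // mul1r (le_trans d1) // ler1n.
have nR : 0 < n%:R :> R by rewrite ltr0n.
have e0 : 0 < e by exact: expR_gt0.
have p0 : 0 < e^-1 by rewrite invr_gt0.
have p1 : e^-1 <= 1 by rewrite invf_le1 // -[leLHS]expR0 ler_expR ltW.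
have q16 : 16 * ln (2 / del) <= n%:R * e^-1.
  have a0 : 0 < 16 * ln (2 / del) by rewrite mulr_gt0.
  rewrite ler_pdivlMr //; move: heps.
  by rewrite -ler_expR lnK ?posrE ?divr_gt0 // ler_pdivlMr // mulrC.
pose x0 := 8 * Num.sqrt (e * ln (4 / del)) / Num.sqrt n%:R.
have x00 : 0 <= x0 by rewrite divr_ge0 ?mulr_ge0 ?sqrtr_ge0.
have x0X : x0 <= X by rewrite /X lerDl divr_ge0 ?mulr_ge0 ?(ltW e0) // ltW.
have x02 : x0 ^+ 2 * (n%:R * e^-1) = 64 * ln (4 / del).
  rewrite /x0 expr_div_n exprMn !sqr_sqrtr ?(ltW nR) ?mulr_ge0 ?(ltW e0) //.
  by field; rewrite !gt_eqF.
pose m := n.-1%:R * e^-1 : R.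
have hm : n%:R * e^-1 - 1 <= m.
  rewrite /m -{1}(prednK n0) -natr1 mulrDl mul1r; lra.
have [t t0 ht] := clone_moment_bound (introT andP (conj d0 d1)) q16 hm x00 x02.
exists t => //.
have tX : expR (- ((1 + X) * t)) <= expR (- ((1 + x0) * t)).
  by rewrite ler_expR lerN2 ler_wpM2r // lerD2l.
have h1 : 1 - e^-1 + e^-1 / 2 * (expR t + expR (- ((1 + X) * t))) <=
    expR (e^-1 / 2 * (expR t + expR (- ((1 + x0) * t)) - 2)).
  apply: le_trans (expR_ge1Dx _); have p2 : 0 <= e^-1 / 2 by lra.
  have := ler_wpM2l p2 tX; lra.
have h0 : 0 <= 1 - e^-1 + e^-1 / 2 * (expR t + expR (- ((1 + X) * t))).
  by rewrite addr_ge0 ?subr_ge0 // mulr_ge0 ?divr_ge0 ?(ltW p0) // addr_ge0 ?expR_ge0.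
apply: le_trans (ler_wpM2l (expR_ge0 t) (lerXn2r n.-1 _ _ h1)) _; rewrite ?nnegrE ?expR_ge0 //.
rewrite -expRM_natl -expRD -[leRHS]lnK ?posrE // ler_expR.
apply: le_trans ht; rewrite /m; lra.
Qed.

Section Amplification.
Variables (R : realType) (n : nat) (eps0 del0 : R) (D : Type)
    (dS : nat -> measure_display) (S : forall i, measurableType (dS i))
    (Rz : forall i, D -> R.-pker (hist S i) ~> S i) (del : R).
Hypotheses (eps00 : 0 < eps0) (del00 : 0 <= del0).
Hypothesis Rz_dp : forall i : nat, (i < n)%N -> forall h : hist S i,
     dp_local_randomizer (fun x : D => Rz i x h) eps0 del0.
Hypothesis del01 : 0 < del <= 1.
Hypothesis eps0_le : eps0 <= ln (n%:R / (16 * ln (2 / del))).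
Let X := 8 * Num.sqrt (expR eps0 * ln (4 / del)) / Num.sqrt n%:R + 8 * expR eps0 / n%:R.
Let eps := ln (1 + (expR eps0 - 1) / (expR eps0 + 1) * X).

Lemma expR_gt1_eps0 : 1 < expR eps0.
Proof. by rewrite expR_gt1. Qed.

Lemma slack_ge0 : 0 <= X.
Proof.
by rewrite addr_ge0 // divr_ge0 ?mulr_ge0 ?sqrtr_ge0 ?expR_ge0.
Qed.

Lemma slope_ge0 : 0 <= (expR eps0 - 1) / (expR eps0 + 1).
Proof.
apply: divr_ge0; last by rewrite addr_ge0 ?expR_ge0.
by rewrite subr_ge0 ltW // expR_gt1_eps0.
Qed.

Lemma expR_eps : expR eps = 1 + (expR eps0 - 1) / (expR eps0 + 1) * X.
Proof. by rewrite lnK // posrE ltr_pwDl // mulr_ge0 ?slack_ge0 ?slope_ge0. Qed.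

Lemma expR_eps_ge1 : 1 <= expR eps.
Proof. by rewrite expR_eps lerDl mulr_ge0 ?slack_ge0 ?slope_ge0. Qed.

Lemma test_fun_indic E : measurable E -> test_fun (fun z : hist S n => (\1_E z)%:E : \bar R).
Proof.
move=> mE; split; first by apply/measurable_EFinP; exact: measurable_indic.
by move=> z; rewrite !lee_fin indicE; case: (_ \in _); rewrite ?lexx ?ler01.
Qed.

Lemma perm_run_test (x : 'I_n -> D) pi E : measurable E ->
  perm_run_prob Rz x pi E = (fine (perm_run_prob Rz x pi E))%:E.
Proof.
move=> mE; rewrite fineK //.
have [_ b] := test_fun_cont Rz x pi (test_fun_cast (esym (addn0 n)) (test_fun_indic mE)).
have /andP[b0 b1] := b tt; rewrite /perm_run_prob ge0_fin_numE //.
exact: le_lt_trans b1 (ltry _).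
Qed.

Lemma shuffled_probE (x : 'I_n -> D) E : measurable E -> shuffled_prob Rz x E =
  ((n`!%:R)^-1 * \sum_pi fine (perm_run_prob Rz x pi E))%:E.
Proof.
move=> mE; rewrite /shuffled_prob EFinM -sumEFin; congr (_ * _)%E.
by apply: eq_bigr => pi _; exact: perm_run_test.
Qed.

Lemma run_excess (xs : bool -> 'I_n -> D) (u0 : 'I_n) E : measurable E ->
  (forall u, u != u0 -> xs true u = xs false u) ->
  \sum_pi (fine (perm_run_prob Rz (xs false) pi E) -
           expR eps * fine (perm_run_prob Rz (xs true) pi E)) <=
  n`!%:R * (del + (expR eps + 1) * (1 + expR (- eps0) / 2) * n%:R * del0).
Proof.
move=> mE xsE; set e := expR eps0.
have n0 : (0 < n)%N by exact: leq_ltn_trans (ltn_ord u0).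
have e1 : 1 < e := expR_gt1_eps0.
have e0 : 0 < e := expR_gt0 _.
have p1 : e^-1 <= 1 by rewrite invf_le1 // ltW.
have p0 : 0 < e^-1 by rewrite invr_gt0.
have al01 : 1 / 2 <= e / (e + 1) <= 1.
  have e10 : 0 < e + 1 by rewrite addr_gt0.
  by apply/andP; split; rewrite ?ler_pdivlMr ?ler_pdivrMr //; lra.
have Dal : 2 * (e / (e + 1)) - 1 = (e - 1) / (e + 1).
  by field; rewrite gt_eqF // addr_gt0.
(* These coefficients make the combination of [cont_bound] the excess of one run over [expR eps]
   times the other; by [Dal], [expR eps] is the factor 1 + (2 al - 1) X of [total_excess_bound]. *)
pose c (s : bool) (pi : 'S_n) : R := if s then expR eps else 1.
have c0 s pi : 0 <= c s pi by case: s; rewrite /c ?expR_ge0.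
have dp i : (i < n)%N -> forall (h : hist S i) a b A, measurable A ->
    (Rz i a h A <= e%:E * Rz i b h A + del0%:E)%E.
  by move=> lin h a b A mA; have [] := Rz_dp lin h a b mA.
have := @cont_bound R D dS S n Rz u0 e del0 xs e1 del00 xsE dp n 0%N _ c tt (addn0 n)
  (test_fun_cast (esym (addn0 n)) (test_fun_indic mE)) c0.
rewrite (eq_bigr (fun pi => fine (perm_run_prob Rz (xs false) pi E) -
           expR eps * fine (perm_run_prob Rz (xs true) pi E))); last first.
  by move=> pi _; rewrite /c mul1r.
move=> h; apply: le_trans h _.
have [t t0 ht] := clone_moment_le n0 eps00 del01 eps0_le.
have tot := @total_excess_bound R n u0 e^-1 _ X t (e / (e + 1)) slack_ge0 t0 al01.
rewrite mulrDr; apply: lerD.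
  apply: (@le_trans _ _ (n`!%:R * (expR t *
    (1 - e^-1 + e^-1 / 2 * (expR t + expR (- ((1 + X) * t)))) ^+ n.-1))); last first.
    exact: ler_wpM2l.
  apply: le_trans (tot _); last by rewrite ltW.
  rewrite (reindex (fun w : {ffun 'I_n -> bool + 'I_n} => [tuple w k | k < n])) /=; last first.
    exists (fun w : n.-tuple (bool + 'I_n) => [ffun k => tnth w k]) => w _.
      by apply/ffunP => k; rewrite ffunE tnth_mktuple.
    by apply: eq_from_tnth => k; rewrite tnth_mktuple ffunE.
  apply: ler_sum => w _; rewrite le_eqVlt; apply/orP; left; apply/eqP; congr Num.max.
  apply: eq_bigr => pi _; rewrite /c mul1r Dal -expR_eps.
  have W s : \prod_(k < n) time_weight u0 e s pi (0 + k) (tnth [tuple w k | k < n] k) =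
      \prod_k mixed_weight u0 e^-1 (e / (e + 1)) s (pi k) (w k).
    by apply: eq_bigr => k _; rewrite add0n /time_weight valK tnth_mktuple.
  by rewrite !W.
rewrite (eq_bigr (fun=> (1 + e^-1) * del0 + expR eps * (e^-1 * del0))); last first.
  by move=> pi _; rewrite /c mul1r.
rewrite sumr_const card_Sn -[_ *+ n`!]mulr_natl mulrCA ler_wpM2l //.
rewrite expRN -/e.
have -> : (expR eps + 1) * (1 + e^-1 / 2) * n%:R * del0 =
  n%:R * ((expR eps + 1) * (1 + e^-1 / 2) * del0) by ring.
apply: ler_wpM2l => //.
rewrite mulrA -mulrDl; apply: ler_wpM2r => //.
(* What remains is 1 + e^-1 + expR eps * e^-1 <= (expR eps + 1)(1 + e^-1/2), which follows from e^-1
   <= 1 <= expR eps. *)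
have ee := expR_eps_ge1.
have := ler_wpM2l (expR_ge0 eps) p1; have := ler_wpM2l (ltW p0) ee; lra.
Qed.

Lemma shuffled_excess (xs : bool -> 'I_n -> D) (u0 : 'I_n) E : measurable E ->
  (forall u, u != u0 -> xs true u = xs false u) ->
  (shuffled_prob Rz (xs false) E <= (expR eps)%:E * shuffled_prob Rz (xs true) E +
    (del + (expR eps + 1) * (1 + expR (- eps0) / 2) * n%:R * del0)%:E)%E.
Proof.
move=> mE xsE; rewrite !shuffled_probE // -EFinM -EFinD lee_fin.
have f0 : 0 < n`!%:R :> R by rewrite ltr0n fact_gt0.
have := run_excess mE xsE; rewrite sumrB -mulr_sumr.
move=> h; rewrite -(ler_pM2l f0) mulrDr [X in _ <= X + _]mulrCA !mulVKf ?gt_eqF //; lra.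
Qed.

End Amplification.

Theorem theorem3p8 (R : realType) (n : nat) (eps0 del0 : R) (D : Type)
    (dS : nat -> measure_display) (S : forall i, measurableType (dS i))
    (Rz : forall i, D -> R.-pker (hist S i) ~> S i) :
  0 < eps0 -> 0 <= del0 <= 1 ->
  (forall i : nat, (i < n)%N -> forall h : hist S i,
     dp_local_randomizer (fun x : D => Rz i x h) eps0 del0) ->
  forall del : R, 0 < del <= 1 ->
  eps0 <= ln (n%:R / (16 * ln (2 / del))) ->
  let eps := ln (1 + (expR eps0 - 1) / (expR eps0 + 1) *
               (8 * Num.sqrt (expR eps0 * ln (4 / del)) / Num.sqrt n%:R
                + 8 * expR eps0 / n%:R)) in
  dp_algorithm (@shuffled_prob R D dS S n Rz) eps
    (del + (expR eps + 1) * (1 + expR (- eps0) / 2) * n%:R * del0).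
Proof.
move=> eps00 /andP[del00 _] Rz_dp del del01 eps0_le eps x x' [u0 [_ xx']] E mE.
have key (xs : bool -> 'I_n -> D) := @shuffled_excess R n eps0 del0 D dS S Rz del
  eps00 del00 Rz_dp del01 eps0_le xs u0 E mE.
split; last exact: (key (fun b => if b then x' else x) (fun u uu0 => esym (xx' u uu0))).
(* The lower inequality is the upper one with the datasets exchanged, solved for the other
   probability. *)
have := key (fun b => if b then x else x') (fun u uu0 => xx' u uu0).
rewrite /= !shuffled_probE // -/eps.
rewrite -EFinM -!EFinD -EFinM !lee_fin [expR (- eps)]expRN => h.
rewrite ler_pdivrMl ?expR_gt0 //; lra.
Qed.
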